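(* For all integers $k, t \geq 2$, \[R_2(t; k) \leq \left\lceil \log R(K_s^{(r)}; k + 1) \right\rceil,\] where $s = 2^t - 1$ and $r = 2^{t - 1}$.
   Context: $\mathrm{PG}(n-1,2)$ denotes the projective space of $\mathbb{F}_2^n$; its points are identified with the nonzero vectors of $\mathbb{F}_2^n$. A $(t-1)$-dimensional projective subspace (also called a $(t-1)$-flat) of $\mathrm{PG}(n-1,2)$ is the set of nonzero vectors of a $t$-dimensional linear subspace of $\mathbb{F}_2^n$. For integers $t,k \geq 1$, the multicolor vector space Ramsey number $R_2(t;k)$ is the least integer $n$ such that every $k$-coloring of the points of $\mathrm{PG}(n-1,2)$ (i.e. every assignment of one of $k$ colors to each point) contains a monochromatic $(t-1)$-dimensional projective subspace. For an $r$-uniform hypergraph $H$, $R(H;k)$ denotes the smallest $n$ such that every $k$-coloring of the $r$-element subsets of $[n]=\{1,\dots,n\}$ contains a monochromatic copy of $H$. $K_s^{(r)}$ denotes the complete $r$-uniform hypergraph on $s > r$ vertices. $\log$ denotes the base-two logarithm. *)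

(* Defs.v *)
From HB Require Import structures.
From mathcomp Require Import all_boot all_order all_algebra.
From mathcomp Require Import reals exp.

Set Implicit Arguments.
Unset Strict Implicit.
Unset Printing Implicit Defensive.

Import Order.TTheory GRing.Theory Num.Theory.

Definition is_least (P : nat -> Prop) (n : nat) : Prop :=
  P n /\ forall m : nat, P m -> m >= n.

Definition log2 (R : realType) (x : R) : R := (ln x / ln 2)%R.

Definition PG2_point (n : nat) := {v : 'rV['F_2]_n | v != 0%R}.

(* [t] is the linear dimension; the projective dimension is [t - 1]. *)
Definition is_flat (n t : nat) (F : {set PG2_point n}) : Prop :=
  exists2 U : {vspace 'rV['F_2]_n},
    \dim U = t & F = [set p : PG2_point n | val p \in U].

Definition has_mono_flat (t k n : nat) : Prop :=
  forall c : PG2_point n -> 'I_k,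
  exists (F : {set PG2_point n}) (i : 'I_k),
    is_flat t F /\ forall p, p \in F -> c p = i.

(* [is_R2 t k n] : n = R_2(t; k) *)
Definition is_R2 (t k n : nat) : Prop := is_least (has_mono_flat t k) n.

Record uhypergraph (r : nat) := UHypergraph {
  vertex : finType;
  edges : {set {set vertex}};
  edges_uniform : forall e, e \in edges -> #|e| = r
}.

Definition rsubset (r n : nat) := {e : {set 'I_n} | #|e| == r}.

Definition has_mono_copy (r : nat) (H : uhypergraph r) (k n : nat) : Prop :=
  forall c : rsubset r n -> 'I_k,
  exists (f : vertex H -> 'I_n) (i : 'I_k),
    injective f /\
    forall (e : {set vertex H}) (x : rsubset r n),
      e \in edges H -> val x = f @: e -> c x = i.

(* [is_ramsey H k N] : N = R(H; k) *)
Definition is_ramsey (r : nat) (H : uhypergraph r) (k N : nat) : Prop :=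
  is_least (has_mono_copy H k) N.

Fact complete_uniform (r s : nat) (e : {set 'I_s}) :
  e \in [set e : {set 'I_s} | #|e| == r] -> #|e| = r.
Proof. by rewrite inE => /eqP. Qed.

Definition complete_uhypergraph (r s : nat) : uhypergraph r :=
  UHypergraph (@complete_uniform r s).

(* Main.v *)
(** View the [N <= 2 ^ n] vertices as distinct vectors of F_2^n and colour each
    [r]-subset by the colour of its sum, with an extra colour when the sum is 0.
    In a monochromatic [s]-set not all [r]-subsets have sum 0, since exchanging
    one element changes the sum; so all their sums are points of one colour.
    Index the [s] vectors as u_x by the nonzero x in F_2^t. For nonzero a, the
    set of x with a.x = 1 has [r] elements, and a |-> \sum_(x | a.x = 1) u_x is
    linear and never zero, so its image is a monochromatic flat. *)

Require Import Defs.
From mathcomp Require Import all_boot all_order all_algebra.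
From mathcomp Require Import reals exp.
From mathcomp Require boolp.

Set Implicit Arguments.
Unset Strict Implicit.
Unset Printing Implicit Defensive.

Import Order.TTheory GRing.Theory Num.Theory.

Lemma is_least_exists (P : nat -> Prop) (m : nat) :
  P m -> exists2 n, is_least P n & n <= m.
Proof.
move=> Pm; have exP : exists n, boolp.asbool (P n).
  by exists m; apply/boolp.asboolP.
case: (ex_minnP exP) => n /boolp.asboolP Pn minP; exists n.
  by split=> // j Pj; apply: minP; apply/boolp.asboolP.
by apply: minP; apply/boolp.asboolP.
Qed.

(** * Ramsey's theorem for hypergraphs *)

Definition homogeneous (T : finType) (C : Type) (c : {set T} -> C) (r : nat)
    (B : {set T}) (i : C) : Prop :=
  forall e : {set T}, e \subset B -> #|e| = r -> c e = i.

(** Colouring sets of every size, inside any [A], keeps the notion stable under passing to a subset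
    and to the colouring [c (x |: e)], as the induction on [r] requires. *)
Definition ramsey_bound (C : Type) (r m N : nat) : Prop :=
  forall (T : finType) (A : {set T}) (c : {set T} -> C), N <= #|A| ->
  exists (B : {set T}) (i : C),
    [/\ B \subset A, #|B| = m & homogeneous c r B i].

Lemma exists_subset_card (T : finType) (A : {set T}) (m : nat) :
  m <= #|A| -> exists2 B : {set T}, B \subset A & #|B| = m.
Proof.
move=> le_mA; exists [set x in take m (enum A)].
  by apply/subsetP=> x; rewrite inE => /mem_take; rewrite mem_enum.
rewrite cardsE; have /card_uniqP -> : uniq (take m (enum A)).
  by rewrite take_uniq ?enum_uniq.
by rewrite size_takel // -cardE.
Qed.

Lemma pigeonhole_fiber (T C : finType) (B : {set T}) (f : T -> C) (m : nat) :
  #|C| * m < #|B| -> exists i, m < #|[set x in B | f x == i]|.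
Proof.
move=> ltB; apply/existsP; rewrite -[[exists _, _]]negbK negb_exists.
apply/negP=> /forallP small; move: ltB; rewrite ltnNge => /negP; apply.
rewrite -sum1_card (partition_big f xpredT) //= -sum_nat_const.
apply: leq_sum => i _; move: (small i); rewrite -leqNgt -sum1_card.
by rewrite (eq_bigl (fun x => (x \in B) && (f x == i))) // => x; rewrite inE.
Qed.

(* In the resulting set the colour of an [r.+1]-subset depends only on its
   minimum for the ranking [g]. *)
Lemma exists_min_determined (C : Type) (r : nat) :
    (forall m, exists N, ramsey_bound C r m N) ->
  forall L, exists N, forall (T : finType) (A : {set T}) (c : {set T} -> C),
  N <= #|A| -> exists (B : {set T}) (f : T -> C) (g : T -> nat),
    [/\ B \subset A, #|B| = L &
        forall (e : {set T}) (x : T), e \subset B -> #|e| = r.+1 -> x \in e ->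
          (forall y, y \in e -> g x <= g y) -> c e = f x].
Proof.
move=> IHr; elim=> [|L [NL IHL]].
  exists 0 => T A c _; exists set0, (fun=> c set0), (fun=> 0); split.
  - exact: sub0set.
  - exact: cards0.
  - by move=> e x; rewrite subset0 => /eqP ->; rewrite cards0.
have [N ramN] := IHr NL; exists N.+1 => T A c ltNA.
have /card_gt0P [x xA] : 0 < #|A| by apply: leq_ltn_trans ltNA.
have leN : N <= #|A :\ x| by move: ltNA; rewrite (cardsD1 x) xA add1n ltnS.
(* All [r]-subsets of [D] get the same colour [i] once [x] is added. The rest of [B] is chosen
   inside [D], so [x] can be ranked lowest, with colour [i]. *)
have [D [i [sDA cardD homD]]] := ramN T (A :\ x) (fun e => c (x |: e)) leN.
have [|B [f [g [sBD cardB minB]]]] := IHL T D c; first by rewrite cardD.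
have xB : x \notin B.
  by apply/negP=> /(subsetP sBD) /(subsetP sDA); rewrite !inE eqxx.
exists (x |: B), (fun y => if y == x then i else f y),
  (fun y => if y == x then 0 else (g y).+1); split.
- rewrite subUset sub1set xA; apply: subset_trans sBD _.
  by apply: subset_trans sDA _; apply: subD1set.
- by rewrite cardsU1 xB cardB.
- move=> e y sexB carde ye miny; have [xe|xe] := boolP (x \in e).
    have := miny x xe; rewrite eqxx; case: eqP => // _ _.
    rewrite -(setD1K xe); apply: homD.
      by apply: subset_trans sBD; rewrite subDset.
    by move: carde; rewrite (cardsD1 x) xe add1n => -[].
  have neq z : z \in e -> (z == x) = false.
    by move=> ze; apply/negP=> /eqP zx; rewrite -zx ze in xe.
  rewrite neq //; apply: minB => //.
    apply/subsetP=> z ze; have := subsetP sexB z ze.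
    by rewrite !inE neq.
  by move=> z ze; have := miny z ze; rewrite !neq.
Qed.

(** Induction on [r]: in a set where the minimum decides the colour, the pigeonhole principle gives
    [m] elements that decide for the same colour. *)
Theorem ramsey_hypergraph (C : finType) (r m : nat) :
  exists N, ramsey_bound C r m N.
Proof.
elim: r m => [|r IHr] m.
  exists m => T A c /exists_subset_card [B sBA cardB].
  by exists B, (c set0); split=> // e _ /eqP; rewrite cards_eq0 => /eqP ->.
have [N minN] := exists_min_determined IHr (#|C| * m).+1.
exists N => T A c /minN -/(_ c) [B [f [g [sBA cardB minB]]]].
have [|i /ltnW /exists_subset_card [D sD cardD]] :=
  @pigeonhole_fiber _ _ B f m; first by rewrite cardB.
have sDB : D \subset B.
  by apply: subset_trans sD _; apply/subsetP=> x; rewrite inE => /andP[].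
exists D, i; split=> //; first exact: subset_trans sBA.
move=> e seD carde.
have /card_gt0P [x0 x0e] : 0 < #|e| by rewrite carde.
case: (@arg_minnP _ x0 (mem e) g x0e) => x xe minx.
rewrite (minB e x) //; last exact: subset_trans sDB.
by have /(subsetP seD)/(subsetP sD) := xe; rewrite inE => /andP[_ /eqP].
Qed.

Lemma has_mono_copy_complete_exists (r s k : nat) :
  0 < k -> exists N, has_mono_copy (complete_uhypergraph r s) k N.
Proof.
case: k => // k _; have [N ramN] := @ramsey_hypergraph 'I_k.+1 r s.
exists N => c.
have [|B [i [_ cardB homB]]] :=
  (* The default [ord0] only colours sets whose size is not [r]. *)
  ramN 'I_N setT (fun e => if insub e is Some x then c x else ord0).
  by rewrite cardsT card_ord.
exists (fun j => enum_val (cast_ord (esym cardB) j)), i; split.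
  by move=> j j' /enum_val_inj /cast_ord_inj.
move=> e x _ xe; have := homB (val x); rewrite valK.
apply; last exact/eqP/(valP x).
by rewrite xe; apply/subsetP=> _ /imsetP [j _ ->]; apply: enum_valP.
Qed.

Lemma expn_pred_lt (t : nat) : 1 < t -> 2 ^ (t - 1) < 2 ^ t - 1.
Proof.
case: t => [|[|t]] // _; rewrite subSS subn0 (expnS _ t.+1) mul2n -addnn.
by rewrite -addnBA ?expn_gt0 // -ltn_subLR // subnn subn_gt0 -{1}(expn0 2) ltn_exp2l.
Qed.

(** * Linear algebra over F_2 *)

Section Geometry.

Local Open Scope ring_scope.

Lemma F2_neq0 (x : 'F_2) : (x != 0) = (x == 1).
Proof. by case: x => [[|[|]]]. Qed.

Lemma card_PG2_point n : #|{: PG2_point n}| = (2 ^ n - 1)%N.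
Proof.
rewrite card_sig (eq_card (B := predC1 0)) ?cardC1 //.
by rewrite card_mx card_Fp // mul1n subn1.
Qed.

(** Translation by a vector [d] with a.d = 1 exchanges the set with its complement, so it contains
    half of the 2^t vectors. *)
Lemma card_affine_hyperplane t (a : 'rV['F_2]_t) : a != 0 ->
  #|[set x : PG2_point t | (a *m (val x)^T) 0 0 != 0]| = (2 ^ (t - 1))%N.
Proof.
move=> a0; pose H := [set x : 'rV['F_2]_t | (a *m x^T) 0 0 != 0].
have -> : #|[set x : PG2_point t | (a *m (val x)^T) 0 0 != 0]| = #|H|.
  rewrite -(card_imset _ val_inj); apply: eq_card => x; apply/imsetP/idP.
    by move=> [y]; rewrite !inE => yH ->.
  rewrite inE => xH; have x0 : x != 0.
    by apply: contraNneq xH => ->; rewrite trmx0 mulmx0 mxE.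
  by exists (Sub x x0); rewrite ?inE.
have [j aj] : exists j, a 0 j != 0.
  apply/existsP; apply: contraNT a0; rewrite negb_exists => /forallP aj.
  by apply/eqP/rowP=> j; rewrite mxE; apply/eqP; move: (aj j); rewrite negbK.
pose d : 'rV['F_2]_t := delta_mx 0 j.
have da : (a *m d^T) 0 0 = 1.
  rewrite trmx_delta -colE mxE; apply/eqP; by rewrite -F2_neq0.
have cardHC : #|~: H| = #|H|.
  rewrite -(card_imset _ (addrI d)); apply: eq_card => x; apply/imsetP/idP.
    move=> [y]; rewrite !inE negbK => /eqP yH ->.
    by rewrite linearD mulmxDr [X in X != 0]mxE da yH addr0 oner_eq0.
  rewrite inE F2_neq0 => /eqP xH; exists (x - d); last by rewrite addrC subrK.
  by rewrite !inE negbK linearB mulmxBr [X in X == 0]mxE [X in _ + X]mxE da xH subrr.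
have t0 : (0 < t)%N := leq_ltn_trans (leq0n j) (ltn_ord j).
have := cardsC H; rewrite cardHC card_mx card_Fp // mul1n addnn => cardH.
by apply: double_inj; rewrite cardH -mul2n -expnS subn1 prednK.
Qed.

(** In a set of r + 1 elements, omitting x or omitting y gives sums that differ by [u x - u y] up to
    sign, so one of them is nonzero. *)
Lemma exists_subset_sum_neq0 (T : finType) (V : zmodType) (u : T -> V) (r : nat) :
    injective u -> (0 < r < #|T|)%N ->
  exists2 e : {set T}, #|e| = r & \sum_(x in e) u x != 0.
Proof.
move=> inj_u /andP[r0 rT].
have [|A _ cardA] := @exists_subset_card _ [set: T] r.+1; first by rewrite cardsT.
have /card_gt1P [x [y [xA yA neq_xy]]] : (1 < #|A|)%N by rewrite cardA ltnS.
have cardD z : z \in A -> #|A :\ z| = r.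
  by move=> zA; move: cardA; rewrite (cardsD1 z) zA => -[].
have [sx0|] := eqVneq (\sum_(z in A :\ x) u z) 0; last by exists (A :\ x); auto.
have [sy0|] := eqVneq (\sum_(z in A :\ y) u z) 0; last by exists (A :\ y); auto.
case/eqP: neq_xy; apply: inj_u.
have := big_setD1 (aop := +%R) x xA (F := u).
by rewrite (big_setD1 y yA) /= sx0 sy0 !addr0.
Qed.

(* The points of the flat are the sums [\sum_(x | a.x = 1) u x] for [a != 0];
   since a.x takes values in {0, 1}, they are the values of a linear map. *)
Lemma mono_flat_of_mono_sums (t n : nat) (C : eqType) (c : PG2_point n -> C)
    (u : PG2_point t -> 'rV['F_2]_n) (q : option C) :
    (1 < t)%N -> injective u ->
    (forall e : {set PG2_point t}, #|e| = (2 ^ (t - 1))%N ->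
       omap c (insub (\sum_(x in e) u x)) = q) ->
  exists (F : {set PG2_point n}) (i : C),
    is_flat t F /\ forall p, p \in F -> c p = i.
Proof.
move=> t1 inj_u mono_u.
(* [None] is the colour of the zero sum. *)
have [i qi] : exists i, q = Some i.
  have [|e carde e0] := @exists_subset_sum_neq0 _ _ u (2 ^ (t - 1)) inj_u.
    by rewrite expn_gt0 card_PG2_point expn_pred_lt.
  by have := mono_u e carde; case: insubP => [p _ _ <-|/negP //]; exists (c p).
subst q.
pose M := \sum_x (val x)^T *m u x.
have mulM a : a *m M = \sum_(x in [set x | (a *m (val x)^T) 0 0 != 0]) u x.
  rewrite mulmx_sumr [RHS]big_mkcond /=; apply: eq_bigr => x _.
  rewrite mulmxA inE [a *m _]mx11_scalar mul_scalar_mx.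
  rewrite [in X in _ = (if X then _ else _)]mxE eqxx mulr1n.
  case: eqP => [->|/eqP]; rewrite ?scale0r //= F2_neq0 => /eqP->.
  by rewrite scale1r.
have sum_mono a : a != 0 -> omap c (insub (a *m M)) = Some i.
  by move=> a0; rewrite mulM mono_u // card_affine_hyperplane.
pose f : 'Hom('rV['F_2]_t, 'rV['F_2]_n) := linfun (mulmxr M).
have fE a : f a = a *m M by rewrite lfunE.
(* For nonzero [a] the vector [a *m M] has a colour, so it is a point; hence the image of [f] has
   dimension [t]. *)
have ker_f : lker f == 0%VS.
  rewrite -subv0; apply/subvP=> a; rewrite memv_ker memv0 fE.
  by apply: contraTT => /sum_mono; case: insubP.
exists [set p | val p \in limg f], i; split.
  exists (limg f) => //; rewrite limg_dim_eq; last by rewrite (eqP ker_f) capv0.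
  by rewrite dimvf /dim /= mul1n.
move=> p; rewrite inE => /memv_imgP [a _]; rewrite fE => pa.
have a0 : a != 0 by apply: contraTneq (valP p) => a0; rewrite pa a0 mul0mx eqxx.
by have := sum_mono a a0; rewrite -pa valK => -[].
Qed.

Lemma has_mono_flat_of_mono_copy (t k n N : nat) :
    (1 < t)%N -> (N <= 2 ^ n)%N ->
    has_mono_copy (complete_uhypergraph (2 ^ (t - 1)) (2 ^ t - 1)) (k + 1) N ->
  has_mono_flat t k n.
Proof.
move=> t1 leN monoN c.
have leNV : (N <= #|{: 'rV['F_2]_n}|)%N by rewrite card_mx card_Fp // mul1n.
pose g (j : 'I_N) : 'rV['F_2]_n := enum_val (widen_ord leNV j).
have inj_g : injective g.
  by move=> j j' /enum_val_inj /(congr1 val) /= /val_inj.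
(* The last of the k + 1 colours encodes a zero sum. *)
pose code (o : option 'I_k) : 'I_(k + 1) :=
  unsplit (if o is Some i then inl i else inr ord0).
have inj_code : injective code.
  by move=> [i|] [i'|] /(can_inj (@unsplitK _ _)) // [->].
pose col (e : {set 'I_N}) := omap c (insub (\sum_(j in e) g j)).
have [f [i [inj_f monof]]] := monoN (fun x => code (col (val x))).
pose b (x : PG2_point t) : 'I_(2 ^ t - 1) :=
  cast_ord (card_PG2_point t) (enum_rank x).
have inj_b : injective b by move=> x y /cast_ord_inj /enum_rank_inj.
have inj_fb : injective (f \o b) by apply: inj_comp.
have monofb (e : {set PG2_point t}) : #|e| = (2 ^ (t - 1))%N ->
    code (omap c (insub (\sum_(x in e) g (f (b x))))) = i.
  move=> carde; have cardfe : #|(f \o b) @: e| == (2 ^ (t - 1))%N.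
    by rewrite card_imset ?carde.
  have := monof (b @: e)
    (exist (fun A : {set 'I_N} => #|A| == (2 ^ (t - 1))%N) _ cardfe).
  rewrite /= inE card_imset // carde eqxx imset_comp => /(_ isT erefl) <-.
  by rewrite /col -imset_comp big_imset //= => x y _ _ /inj_fb.
(* Any one [e0] serves to express the common colour [i] as a value of [code]. *)
have [|e0 _ carde0] := @exists_subset_card _ [set: PG2_point t] (2 ^ (t - 1)).
  by rewrite cardsT card_PG2_point ltnW // expn_pred_lt.
apply: (@mono_flat_of_mono_sums t n 'I_k c (fun x => g (f (b x)))
  (omap c (insub (\sum_(x in e0) g (f (b x)))))) => //.
  exact: (inj_comp inj_g inj_fb).
by move=> e carde; apply: inj_code; rewrite !monofb.
Qed.

End Geometry.

(** * The logarithm and the final bound *)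

Lemma leq_exp2_ceil_log2 (R : realType) (N : nat) : 0 < N ->
  exists2 n : nat, N <= 2 ^ n & n%:Z%R = Num.ceil (log2 (N%:R : R)).
Proof.
move=> N0; have ln2 : (0 < ln (2 : R))%R by rewrite ln_gt0 // ltr1n.
have : (0 <= Num.ceil (log2 (N%:R : R)))%R.
  rewrite ceil_ge0 // (lt_le_trans (ltrN10 _)) // divr_ge0 ?ln_ge0 ?ler1n //.
case E : (Num.ceil _) => [n|//] _; exists n => //.
have : (log2 (N%:R : R) <= n%:R)%R by have := ceil_ge (log2 (N%:R : R)); rewrite E.
rewrite /log2 ler_pdivrMr // mulr_natl -lnXn // ler_ln ?posrE ?ltr0n ?exprn_gt0 //.
by rewrite -natrX ler_nat.
Qed.

(* Both Ramsey numbers are "the least integer such that ...": their existence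
   is part of the conclusion, and their uniqueness is clear. *)
Theorem lemma1p2 (R : realType) (t k : nat) (ht : 2 <= t) (hk : 2 <= k) :
  exists n N : nat,
    [/\ is_R2 t k n,
        is_ramsey (complete_uhypergraph (2 ^ (t - 1)) (2 ^ t - 1)) (k + 1) N
      & (n%:Z <= Num.ceil (log2 (N%:R : R)))%R].
Proof.
have [|M monoM] := @has_mono_copy_complete_exists (2 ^ (t - 1)) (2 ^ t - 1) (k + 1).
  by rewrite addn1.
have [N ramN _] := is_least_exists monoM.
(* A constant colouring already yields a copy with at least one vertex among the [N]. *)
have N0 : 0 < N.
  have [f _] := ramN.1 (fun=> cast_ord (esym (addn1 k)) ord0).
  have s0 : 0 < 2 ^ t - 1 by rewrite subn_gt0 -{1}(expn0 2) ltn_exp2l // ltnW.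
  exact: leq_ltn_trans (leq0n _) (ltn_ord (f (Ordinal s0))).
have [m leNm ceilN] := leq_exp2_ceil_log2 R N0.
have [n R2n le_nm] := is_least_exists (has_mono_flat_of_mono_copy ht leNm ramN.1).
by exists n, N; split=> //; rewrite -ceilN lez_nat.
Qed.
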